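(* Let $c\in\{-1,0,1\}$, $\alpha\in[0,\pi/2]$, and let $\gamma:I\to M_c$ be a convex closed curve. The $\alpha$-evolutoid of $\gamma$ is the locus of the singular points of the wavefronts of $\gamma$ in the direction $\mathbf{v}_\alpha$; that is, it is the set of all points $\sigma(s)$ with $\sigma'(s)=0$, where $\sigma$ ranges over the wavefronts of $\gamma$ in the direction $\mathbf{v}_\alpha$.
   Context: Space forms: for $c\in\{-1,0,1\}$ equip $\mathbb{R}^3$ with $\langle x,y\rangle_c=c\,x_1y_1+x_2y_2+x_3y_3$ and $\|x\|_c=\sqrt{\langle x,x\rangle_c}$. Let $M_{-1}=\{x:\langle x,x\rangle_{-1}=-1,\ x_1>0\}$, $M_0=\{x: x_1=0\}$, $M_1=\{x:\langle x,x\rangle_1=1\}$, each with the Riemannian metric induced by $\langle\cdot,\cdot\rangle_c$ (constant Gaussian curvature $c$). Trigonometry: $\sin_c(t)=\sinh t,\ t,\ \sin t$ and $\cos_c(t)=\cosh t,\ 1,\ \cos t$ for $c=-1,0,1$ respectively. For $p\in M_c$, a unit vector $v\in T_pM_c$ and $t\in\mathbb{R}$, $\exp^c_p(tv)=\cos_c(t)\,p+\sin_c(t)\,v$. Frenet frame: for an arc-length parametrized curve $\gamma$ in $M_c$, $\mathbf{t}=\gamma'$ and $\mathbf{e}=\gamma\wedge_c\mathbf{t}$ if $c=\pm1$, where $x\wedge_c y=(c(x_2y_3-x_3y_2),\,x_3y_1-x_1y_3,\,x_1y_2-x_2y_1)$, while $\mathbf{e}=\gamma''/\|\gamma''\|_0$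 if $c=0$. The geodesic curvature $k$ is defined by $\nabla_{\gamma'}\gamma'=k\,\mathbf{e}$. A smooth, closed, positively oriented, arc-length parametrized curve is called convex if $k(s)>0$ for all $s$ (when $c=0,1$) or $k(s)>1$ for all $s$ (when $c=-1$). Evolutoids: $\mathbf{v}_\alpha(s)=\cos(\alpha)\mathbf{t}(s)+\sin(\alpha)\mathbf{e}(s)$ and $\mathcal{F}_\alpha(s,t)=\exp^c_{\gamma(s)}(t\,\mathbf{v}_\alpha(s))$ for $s\in I$, $t\in[0,\infty)$. The $\alpha$-evolutoid of $\gamma$ is the image under $\mathcal{F}_\alpha$ of the set of critical points of $\mathcal{F}_\alpha$ (for $c=1$ this comprises two mutually antipodal copies of one curve). Wavefronts: a wavefront of $\gamma$ in the direction $\mathbf{v}_\alpha$ is a curve $\sigma:I\to M_c$ of the form $\sigma(s)=\exp^c_{\gamma(s)}(r(s)\mathbf{v}_\alpha(s))$, for some function $r(s)$, satisfying the orthogonality condition $\langle\sigma'(s),\mathbf{v}^p_\alpha(s)\rangle_c=0$, where $\mathbf{v}^p_\alpha(s)=\frac{d}{dt}\big|_{t=r(s)}\exp^c_{\gamma(s)}(t\mathbf{v}_\alpha(s))$; equivalently $r(s)=C_0-s\cos(\alpha)$ for a constant $C_0\in\mathbb{R}$. *)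

(* Defs.v *)
From Stdlib Require Import Reals.
From Coquelicot Require Import Coquelicot.
Open Scope R_scope.

Notation R3 := (R * R * R)%type.

Definition x1 (x : R3) : R := fst (fst x).
Definition x2 (x : R3) : R := snd (fst x).
Definition x3 (x : R3) : R := snd x.

Inductive space_form : Set := Hyperbolic | Euclidean | Spherical.

Definition curvature (c : space_form) : R :=
  match c with Hyperbolic => -1 | Euclidean => 0 | Spherical => 1 end.

Definition inner (c : space_form) (x y : R3) : R :=
  curvature c * x1 x * x1 y + x2 x * x2 y + x3 x * x3 y.

Definition cnorm (c : space_form) (x : R3) : R := sqrt (inner c x x).

Definition in_M (c : space_form) (x : R3) : Prop :=
  match c with
  | Hyperbolic => inner c x x = -1 /\ 0 < x1 x
  | Euclidean => x1 x = 0
  | Spherical => inner c x x = 1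
  end.

Definition tangent (c : space_form) (p w : R3) : Prop :=
  match c with
  | Euclidean => x1 w = 0
  | _ => inner c p w = 0
  end.

Definition sin_ (c : space_form) (t : R) : R :=
  match c with Hyperbolic => sinh t | Euclidean => t | Spherical => sin t end.

Definition cos_ (c : space_form) (t : R) : R :=
  match c with Hyperbolic => cosh t | Euclidean => 1 | Spherical => cos t end.

(** [Exp c p v t] is exp^c_p (t v), for a unit vector v in T_p M_c. *)
Definition Exp (c : space_form) (p v : R3) (t : R) : R3 :=
  plus (scal (cos_ c t) p) (scal (sin_ c t) v).

Definition wedge (c : space_form) (x y : R3) : R3 :=
  (curvature c * (x2 x * x3 y - x3 x * x2 y),
   x3 x * x1 y - x1 x * x3 y,
   x1 x * x2 y - x2 x * x1 y).

Definition det3 (x y z : R3) : R :=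
  x1 x * (x2 y * x3 z - x3 y * x2 z)
  - x2 x * (x1 y * x3 z - x3 y * x1 z)
  + x3 x * (x1 y * x2 z - x2 y * x1 z).

Definition smooth3 (f : R -> R3) : Prop :=
  forall (n : nat) (s : R),
    ex_derive_n (fun u => x1 (f u)) n s /\
    ex_derive_n (fun u => x2 (f u)) n s /\
    ex_derive_n (fun u => x3 (f u)) n s.

Definition Derive3 (f : R -> R3) (s : R) : R3 :=
  (Derive (fun u => x1 (f u)) s,
   Derive (fun u => x2 (f u)) s,
   Derive (fun u => x3 (f u)) s).

Definition frame_t (g : R -> R3) (s : R) : R3 := Derive3 g s.

Definition frame_e (c : space_form) (g : R -> R3) (s : R) : R3 :=
  match c with
  | Euclidean =>
      scal (/ cnorm c (Derive3 (Derive3 g) s)) (Derive3 (Derive3 g) s)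
  | _ => wedge c (g s) (frame_t g s)
  end.

(** The Levi-Civita covariant derivative of g' along g, i.e. the tangential
    part of g''. As <g,g>_c = c = 1/c for c = 1, -1, the normal part of g'' is
    c <g'',g>_c g; it vanishes for c = 0. *)
Definition cov_accel (c : space_form) (g : R -> R3) (s : R) : R3 :=
  minus (Derive3 (Derive3 g) s)
        (scal (curvature c * inner c (Derive3 (Derive3 g) s) (g s)) (g s)).

(** For c = 0 the vector e is undefined where g'' = 0, in which case
    [frame_e] is zero; no curvature k is then assigned. *)
Definition geodesic_curvature (c : space_form) (g : R -> R3) (k : R -> R) : Prop :=
  forall s : R,
    frame_e c g s <> zero /\ cov_accel c g s = scal (k s) (frame_e c g s).

(** The normal vector orienting T_p M_c: a basis (v, w) of T_p M_c is positive
    when det (normal, v, w) > 0. *)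
Definition normal (c : space_form) (p : R3) : R3 :=
  match c with Euclidean => (1, 0, 0) | _ => p end.

(** The frame (t, e) is positive. This is automatic for c = 1, -1, where the
    orientation is recorded by the sign of k; for c = 0, where k >= 0 always,
    it says that the curve turns counterclockwise in the (x2, x3)-plane. *)
Definition positively_oriented (c : space_form) (g : R -> R3) : Prop :=
  forall s : R, 0 < det3 (normal c (g s)) (frame_t g s) (frame_e c g s).

(** A closed curve of length L, parametrized on I = [0, L], is given by its
    L-periodic extension to the real line. It need not be simple. *)
Record convex_closed_curve (c : space_form) (L : R) (g : R -> R3) : Prop := {
  length_pos : 0 < L;
  curve_in_M : forall s : R, in_M c (g s);
  curve_smooth : smooth3 g;
  curve_closed : forall s : R, g (s + L) = g s;
  curve_arclength : forall s : R, cnorm c (Derive3 g s) = 1;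
  curve_oriented : positively_oriented c g;
  curve_convex : exists k : R -> R,
    geodesic_curvature c g k /\
    forall s : R, match c with Hyperbolic => 1 < k s | _ => 0 < k s end
}.

Definition valpha (c : space_form) (alpha : R) (g : R -> R3) (s : R) : R3 :=
  plus (scal (cos alpha) (frame_t g s)) (scal (sin alpha) (frame_e c g s)).

Definition Falpha (c : space_form) (alpha : R) (g : R -> R3) (s t : R) : R3 :=
  Exp c (g s) (valpha c alpha g s) t.

(** The differential of F at (s, t), (a, b) |-> a F_s + b F_t, is not onto the
    tangent space of M_c at F (s, t). *)
Definition critical_point (c : space_form) (F : R -> R -> R3) (s t : R) : Prop :=
  ~ (forall w : R3, tangent c (F s t) w ->
       exists a b : R,
         w = plus (scal a (Derive3 (fun u => F u t) s))
                  (scal b (Derive3 (fun u => F s u) t))).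

Definition evolutoid (c : space_form) (alpha L : R) (g : R -> R3) (p : R3) : Prop :=
  exists s t : R,
    0 <= s <= L /\ 0 <= t /\
    critical_point c (Falpha c alpha g) s t /\ p = Falpha c alpha g s t.

(** The functions r and sigma on I = [0, L] are represented by extensions to
    the real line, so that two-sided derivatives make sense at 0 and L. *)
Definition wavefront (c : space_form) (alpha L : R) (g : R -> R3)
    (sigma : R -> R3) : Prop :=
  exists r : R -> R,
    (forall s : R, sigma s = Exp c (g s) (valpha c alpha g s) (r s)) /\
    (forall s : R, 0 <= s <= L ->
       ex_derive r s /\
       inner c (Derive3 sigma s)
               (Derive3 (Exp c (g s) (valpha c alpha g s)) (r s)) = 0).

(* Main.v *)
Require Import Defs.
From Stdlib Require Import Reals Lra Nsatz.
From Coquelicot Require Import Coquelicot.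
Open Scope R_scope.

(** With v = v_alpha(s) and the quarter turn J of the tangent planes, put
    n = J v = - sin alpha t + cos alpha e. For c = 1, -1 one has e = J t by
    definition; for c = 0 it follows from positive orientation. So the three
    geometries share the equations t' = k e - c g and e' = - k t
    ([frenet_equations]). They turn into v' = k n - c cos alpha g, and for every
    differentiable r

      d/ds F(s, r(s)) = (cos alpha + r'(s)) F_t
                        + (k(s) sin_c(r) - sin alpha cos_c(r)) n

    ([is_derive3_front]), where F_t is the velocity of the geodesic ray, and
    (F_t, n) is an orthonormal basis of the tangent plane at F(s, r(s)) because
    J F_t is the same vector n at every point of the ray ([rot_ray_velocity]).
    The coefficient of n is called [focal].

    Everything can be read off from this formula. With r constant it gives F_s,
    so F is critical at (s, t) exactly when the focal coefficient vanishes there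
    ([critical_point_iff]). With general r, orthogonality to the ray is
    r' = - cos alpha, and then sigma'(s) = 0 exactly when the focal coefficient
    vanishes at (s, r(s)) ([front_singular_iff]). A critical point (s0, t0) thus
    lies on the wavefront r(s) = t0 - (s - s0) cos alpha.

    The two sides differ only in that the evolutoid uses t >= 0, whereas r may
    be negative. For c = 0, -1 convexity makes every zero of the focal
    coefficient nonnegative, as sin alpha >= 0; for c = 1 the ray runs along a
    great circle, and adding a multiple of 2 pi to r changes nothing
    ([focal_at_nonneg_time]). *)

(** * Vectors of R3 and the forms <.,.>_c *)

Lemma x1_plus (x y : R3) : x1 (plus x y) = x1 x + x1 y.
Proof. reflexivity. Qed.
Lemma x2_plus (x y : R3) : x2 (plus x y) = x2 x + x2 y.
Proof. reflexivity. Qed.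
Lemma x3_plus (x y : R3) : x3 (plus x y) = x3 x + x3 y.
Proof. reflexivity. Qed.
Lemma x1_scal (a : R) (x : R3) : x1 (scal a x) = a * x1 x.
Proof. reflexivity. Qed.
Lemma x2_scal (a : R) (x : R3) : x2 (scal a x) = a * x2 x.
Proof. reflexivity. Qed.
Lemma x3_scal (a : R) (x : R3) : x3 (scal a x) = a * x3 x.
Proof. reflexivity. Qed.

Lemma R3_eq (x y : R3) : x1 x = x1 y -> x2 x = x2 y -> x3 x = x3 y -> x = y.
Proof.
destruct x as [[a b] d], y as [[a' b'] d']; cbn; intros; subst; reflexivity.
Qed.

Lemma x1_triple (a b d : R) : x1 (a, b, d) = a.
Proof. reflexivity. Qed.
Lemma x2_triple (a b d : R) : x2 (a, b, d) = b.
Proof. reflexivity. Qed.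
Lemma x3_triple (a b d : R) : x3 (a, b, d) = d.
Proof. reflexivity. Qed.

Ltac coords :=
  repeat progress rewrite ?x1_plus, ?x2_plus, ?x3_plus,
    ?x1_scal, ?x2_scal, ?x3_scal, ?x1_triple, ?x2_triple, ?x3_triple.

Lemma inner_comm (c : space_form) (x y : R3) : inner c x y = inner c y x.
Proof. unfold inner; ring. Qed.

Lemma inner_plus_l (c : space_form) (x y z : R3) :
  inner c (plus x y) z = inner c x z + inner c y z.
Proof. unfold inner; coords; ring. Qed.

Lemma inner_scal_l (c : space_form) (a : R) (x z : R3) :
  inner c (scal a x) z = a * inner c x z.
Proof. unfold inner; coords; ring. Qed.

Lemma inner_plus_r (c : space_form) (x y z : R3) :
  inner c z (plus x y) = inner c z x + inner c z y.
Proof. unfold inner; coords; ring. Qed.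

Lemma inner_scal_r (c : space_form) (a : R) (x z : R3) :
  inner c z (scal a x) = a * inner c z x.
Proof. unfold inner; coords; ring. Qed.

Lemma tangent_plus (c : space_form) (p x y : R3) :
  tangent c p x -> tangent c p y -> tangent c p (plus x y).
Proof.
destruct c; unfold tangent; rewrite ?inner_plus_r, ?x1_plus; lra.
Qed.

Lemma tangent_scal (c : space_form) (p x : R3) (a : R) :
  tangent c p x -> tangent c p (scal a x).
Proof.
destruct c; unfold tangent; rewrite ?inner_scal_r, ?x1_scal;
  intros ->; ring.
Qed.

(** * The quarter turn of the tangent planes *)

(** The rotation J of T_p M_c by a right angle. Using [normal] instead of p is
    what makes one formula serve all three geometries: for c = 0 it is
    (x2, x3) |-> (- x3, x2). *)
Definition rot (c : space_form) (p u : R3) : R3 := wedge c (normal c p) u.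

(** The only property of p that the algebra of [rot] depends on. In the flat
    case it holds at every p, the normal (1, 0, 0) being null for <.,.>_0. *)
Definition unit_normal (c : space_form) (p : R3) : Prop :=
  inner c (normal c p) (normal c p) = curvature c.

Lemma in_M_unit_normal (c : space_form) (p : R3) : in_M c p -> unit_normal c p.
Proof.
destruct c; unfold unit_normal, normal; cbn [in_M curvature]; try tauto.
intros _; unfold inner; coords; cbn; ring.
Qed.

Lemma rot_plus (c : space_form) (p u v : R3) :
  rot c p (plus u v) = plus (rot c p u) (rot c p v).
Proof. unfold rot, wedge; apply R3_eq; coords; ring. Qed.

Lemma rot_scal (c : space_form) (p u : R3) (a : R) :
  rot c p (scal a u) = scal a (rot c p u).
Proof. unfold rot, wedge; apply R3_eq; coords; ring. Qed.

Lemma tangent_rot (c : space_form) (p u : R3) : tangent c p (rot c p u).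
Proof.
destruct c; unfold tangent, rot, wedge, inner, normal; coords;
  cbn [curvature]; ring.
Qed.

Lemma inner_rot (c : space_form) (p u : R3) : inner c u (rot c p u) = 0.
Proof.
unfold rot, wedge, inner, normal; coords.
destruct c; cbn [curvature]; coords; ring.
Qed.

Lemma rot_rot (c : space_form) (p u : R3) :
  unit_normal c p -> tangent c p u -> rot c p (rot c p u) = scal (-1) u.
Proof.
destruct c; unfold unit_normal, normal, tangent, rot, wedge, inner;
  cbn [curvature]; intros Hp Hu; apply R3_eq; coords; try nsatz.
Qed.

Lemma inner_rot_rot (c : space_form) (p u : R3) :
  unit_normal c p -> tangent c p u ->
  inner c (rot c p u) (rot c p u) = inner c u u.
Proof.
destruct c; unfold unit_normal, normal, tangent, rot, wedge, inner;
  cbn [curvature]; intros Hp Hu; coords; nsatz.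
Qed.

(** The tangent plane is two-dimensional, and J u is a unit vector in it
    orthogonal to u. *)
Lemma tangent_decomposition (c : space_form) (p u w : R3) :
  unit_normal c p -> tangent c p u -> inner c u u = 1 -> tangent c p w ->
  w = plus (scal (inner c w u) u) (scal (inner c w (rot c p u)) (rot c p u)).
Proof.
destruct c; unfold unit_normal, normal, tangent, rot, wedge, inner;
  cbn [curvature]; intros Hp Hu Hn Hw; apply R3_eq; coords; nsatz.
Qed.

(** * Derivatives of curves in R3 *)

Definition is_derive3 (f : R -> R3) (s : R) (l : R3) : Prop :=
  is_derive (fun u => x1 (f u)) s (x1 l) /\
  is_derive (fun u => x2 (f u)) s (x2 l) /\
  is_derive (fun u => x3 (f u)) s (x3 l).

Local Ltac split3 := split; [|split].

Lemma is_derive3_unique (f : R -> R3) (s : R) (l : R3) :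
  is_derive3 f s l -> Derive3 f s = l.
Proof.
intros [H1 [H2 H3]]; apply R3_eq; unfold Derive3; coords;
  apply is_derive_unique; assumption.
Qed.

Lemma is_derive3_ext (f h : R -> R3) (s : R) (l : R3) :
  (forall u, f u = h u) -> is_derive3 f s l -> is_derive3 h s l.
Proof.
intros E [H1 [H2 H3]]; split3;
  [apply (is_derive_ext (fun u => x1 (f u))) |
   apply (is_derive_ext (fun u => x2 (f u))) |
   apply (is_derive_ext (fun u => x3 (f u)))];
  try assumption; intro u; rewrite E; reflexivity.
Qed.

Lemma is_derive3_const (p : R3) (s : R) : is_derive3 (fun _ => p) s zero.
Proof. split3; exact (is_derive_const _ s). Qed.

Lemma is_derive3_plus (f h : R -> R3) (s : R) (l m : R3) :
  is_derive3 f s l -> is_derive3 h s m ->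
  is_derive3 (fun u => plus (f u) (h u)) s (plus l m).
Proof.
intros [F1 [F2 F3]] [H1 [H2 H3]]; split3;
  apply (is_derive_plus (V := R_NormedModule));
  assumption.
Qed.

Lemma is_derive_prod (a b : R -> R) (s a' b' : R) :
  is_derive a s a' -> is_derive b s b' ->
  is_derive (fun u => a u * b u) s (a' * b s + a s * b').
Proof. intros Ha Hb; exact (is_derive_mult a b s a' b' Ha Hb Rmult_comm). Qed.

Lemma is_derive3_scal (a : R -> R) (f : R -> R3) (s a' : R) (l : R3) :
  is_derive a s a' -> is_derive3 f s l ->
  is_derive3 (fun u => scal (a u) (f u)) s
    (plus (scal a' (f s)) (scal (a s) l)).
Proof.
intros Ha [F1 [F2 F3]]; split3; apply is_derive_prod; assumption.
Qed.

Lemma is_derive3_wedge (c : space_form) (f h : R -> R3) (s : R) (l m : R3) :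
  is_derive3 f s l -> is_derive3 h s m ->
  is_derive3 (fun u => wedge c (f u) (h u)) s
    (plus (wedge c l (h s)) (wedge c (f s) m)).
Proof.
intros [F1 [F2 F3]] [H1 [H2 H3]].
assert (minor : forall (a b d e : R -> R) (a' b' d' e' : R),
  is_derive a s a' -> is_derive b s b' ->
  is_derive d s d' -> is_derive e s e' ->
  is_derive (fun u => a u * b u - d u * e u) s
    ((a' * b s - d' * e s) + (a s * b' - d s * e'))).
{ intros a b d e a' b' d' e' Ha Hb Hd He.
  replace ((a' * b s - d' * e s) + (a s * b' - d s * e'))
    with ((a' * b s + a s * b') - (d' * e s + d s * e')) by ring.
  apply (is_derive_minus (V := R_NormedModule)); apply is_derive_prod;
    assumption. }
split3; try (apply minor; assumption).
unfold wedge; coords.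
rewrite <- Rmult_plus_distr_l.
apply is_derive_scal; apply minor; assumption.
Qed.

Lemma is_derive_inner (c : space_form) (f h : R -> R3) (s : R) (l m : R3) :
  is_derive3 f s l -> is_derive3 h s m ->
  is_derive (fun u => inner c (f u) (h u)) s
    (inner c l (h s) + inner c (f s) m).
Proof.
intros [F1 [F2 F3]] [H1 [H2 H3]].
apply (is_derive_ext (fun u => curvature c * (x1 (f u) * x1 (h u))
  + x2 (f u) * x2 (h u) + x3 (f u) * x3 (h u))).
{ intro u; unfold inner; cbn; ring. }
replace (inner c l (h s) + inner c (f s) m) with
  (curvature c * (x1 l * x1 (h s) + x1 (f s) * x1 m)
   + (x2 l * x2 (h s) + x2 (f s) * x2 m)
   + (x3 l * x3 (h s) + x3 (f s) * x3 m)) by (unfold inner; ring).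
apply (is_derive_plus (V := R_NormedModule));
  [apply (is_derive_plus (V := R_NormedModule))|];
  [apply is_derive_scal| |]; apply is_derive_prod; assumption.
Qed.

Lemma is_derive_constant_eq0 (f : R -> R) (d s l : R) :
  (forall u, f u = d) -> is_derive f s l -> l = 0.
Proof.
intros E H; rewrite <- (is_derive_unique _ _ _ H).
rewrite (Derive_ext _ (fun _ => d)); [apply Derive_const | exact E].
Qed.

(** * The trigonometric functions of the space forms *)

Lemma is_derive_cos_ (c : space_form) (t : R) :
  is_derive (cos_ c) t (- curvature c * sin_ c t).
Proof.
destruct c; cbn [cos_ sin_ curvature].
- replace (- -1 * sinh t) with (sinh t) by ring.
  apply is_derive_Reals, derivable_pt_lim_cosh.
- replace (- 0 * t) with 0 by ring; exact (is_derive_const _ t).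
- replace (- (1) * sin t) with (- sin t) by ring.
  apply is_derive_Reals, derivable_pt_lim_cos.
Qed.

Lemma is_derive_sin_ (c : space_form) (t : R) :
  is_derive (sin_ c) t (cos_ c t).
Proof.
destruct c; cbn [cos_ sin_].
- apply is_derive_Reals, derivable_pt_lim_sinh.
- exact (is_derive_id t).
- apply is_derive_Reals, derivable_pt_lim_sin.
Qed.

Lemma cos_sin_sqr (c : space_form) (t : R) :
  cos_ c t * cos_ c t + curvature c * (sin_ c t * sin_ c t) = 1.
Proof.
destruct c; cbn [cos_ sin_ curvature].
- unfold cosh, sinh.
  assert (H : exp t * exp (- t) = 1)
    by (rewrite <- exp_plus, Rplus_opp_r; apply exp_0).
  rewrite <- H; field.
- ring.
- generalize (sin2_cos2 t); unfold Rsqr; lra.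
Qed.

(** * The Frenet frame *)

Lemma Derive3_correct (g : R -> R3) (s : R) :
  smooth3 g -> is_derive3 g s (Derive3 g s).
Proof.
intros H; destruct (H 1%nat s) as [H1 [H2 H3]].
split3; apply Derive_correct; assumption.
Qed.

Lemma Derive3_correct_2 (g : R -> R3) (s : R) :
  smooth3 g -> is_derive3 (Derive3 g) s (Derive3 (Derive3 g) s).
Proof.
intros H; destruct (H 2%nat s) as [H1 [H2 H3]].
split3; apply Derive_correct; assumption.
Qed.

(** The factor c^2 is 1 where the normal is the point itself, and 0 in the flat
    case, where the normal is constant. *)
Lemma is_derive3_normal (c : space_form) (g : R -> R3) (s : R) (l : R3) :
  is_derive3 g s l ->
  is_derive3 (fun u => normal c (g u)) s (scal (curvature c * curvature c) l).
Proof.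
intros H.
assert (E : forall a, a = 1 -> is_derive3 g s (scal a l)).
{ intros a ->; replace (scal 1 l) with l; [exact H|].
  apply R3_eq; coords; ring. }
destruct c; cbn [normal curvature]; try (apply E; ring).
replace (scal (0 * 0) l) with (zero : R3); [apply is_derive3_const|].
apply R3_eq; coords; cbn; ring.
Qed.

Lemma inner_velocity (c : space_form) (L : R) (g : R -> R3) (s : R) :
  convex_closed_curve c L g -> inner c (Derive3 g s) (Derive3 g s) = 1.
Proof.
intros hg; pose proof (curve_arclength _ _ _ hg s) as H; unfold cnorm in H.
destruct (Rle_or_lt 0 (inner c (Derive3 g s) (Derive3 g s))) as [P|P].
- rewrite <- (sqrt_sqrt _ P), H; ring.
- rewrite sqrt_neg_0 in H by lra; lra.
Qed.

Lemma tangent_velocity (c : space_form) (L : R) (g : R -> R3) (s : R) :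
  convex_closed_curve c L g -> tangent c (g s) (Derive3 g s).
Proof.
intros hg; pose proof (curve_in_M _ _ _ hg) as HM.
pose proof (Derive3_correct g s (curve_smooth _ _ _ hg)) as Hd.
assert (E : forall a, (forall u, inner c (g u) (g u) = a) ->
  inner c (g s) (Derive3 g s) = 0).
{ intros a Ha.
  pose proof (is_derive_constant_eq0 _ _ _ _ Ha (is_derive_inner c _ _ _ _ _ Hd Hd))
    as H0.
  rewrite (inner_comm c (Derive3 g s)) in H0; lra. }
destruct c; cbn [tangent in_M] in *.
- apply (E (-1)); intro u; apply HM.
- exact (is_derive_constant_eq0 _ _ _ _ HM (proj1 Hd)).
- exact (E 1 HM).
Qed.

Lemma inner_accel_velocity (c : space_form) (L : R) (g : R -> R3) (s : R) :
  convex_closed_curve c L g ->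
  inner c (Derive3 (Derive3 g) s) (Derive3 g s) = 0.
Proof.
intros hg.
pose proof (Derive3_correct_2 g s (curve_smooth _ _ _ hg)) as Hd.
assert (H1 : forall u, inner c (Derive3 g u) (Derive3 g u) = 1)
  by (intro u; exact (inner_velocity _ _ _ _ hg)).
pose proof (is_derive_constant_eq0 _ _ _ _ H1 (is_derive_inner c _ _ _ _ _ Hd Hd))
  as H0.
rewrite (inner_comm c (Derive3 g s)) in H0; lra.
Qed.

(** For c = 1, -1 this is the derivative of <t, g>_c = 0. The factor c makes the
    statement void for c = 0, where <t, g>_0 need not vanish. *)
Lemma curvature_inner_accel (c : space_form) (L : R) (g : R -> R3) (s : R) :
  convex_closed_curve c L g ->
  curvature c * inner c (Derive3 (Derive3 g) s) (g s) = - curvature c.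
Proof.
intros hg.
pose proof (Derive3_correct g s (curve_smooth _ _ _ hg)) as Hd.
pose proof (Derive3_correct_2 g s (curve_smooth _ _ _ hg)) as Hd2.
pose proof (is_derive_inner c _ _ _ _ _ Hd2 Hd) as H.
rewrite (inner_velocity _ _ _ _ hg) in H.
assert (T : forall u, tangent c (g u) (Derive3 g u))
  by (intro u; exact (tangent_velocity _ _ _ _ hg)).
destruct c; cbn [tangent curvature] in *; [| ring |];
  (apply (is_derive_constant_eq0 _ 0) in H;
   [lra | intro u; rewrite inner_comm; apply T]).
Qed.

(** Only c = 0 needs an argument: there e = g''/|g''| is a unit vector
    orthogonal to the unit vector t, so e = J t or e = - J t, and the orientation
    hypothesis selects J t. *)
Lemma frame_e_rot (c : space_form) (L : R) (g : R -> R3) (s : R) :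
  convex_closed_curve c L g -> frame_e c g s = rot c (g s) (frame_t g s).
Proof.
intros hg; destruct c; try reflexivity.
destruct (curve_convex _ _ _ hg) as [k [Hk _]].
destruct (Hk s) as [He0 _].
pose proof (curve_oriented _ _ _ hg s) as Ho.
pose proof (tangent_velocity _ _ _ s hg) as Ht; cbn [tangent] in Ht.
pose proof (inner_velocity _ _ _ s hg) as H1.
pose proof (inner_accel_velocity _ _ _ s hg) as H2.
assert (Ha : x1 (Derive3 (Derive3 g) s) = 0).
{ refine (is_derive_constant_eq0 (fun u => x1 (Derive3 g u)) 0 s _ _ _).
  - intro u; exact (tangent_velocity _ _ _ u hg).
  - apply (Derive3_correct_2 g s (curve_smooth _ _ _ hg)). }
unfold frame_t in *; cbn [frame_e] in *.
set (t := Derive3 g s) in *; set (a := Derive3 (Derive3 g) s) in *.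
set (m := cnorm Euclidean a) in *.
(* If |g''| = 0 then e = 0 because / 0 = 0. *)
assert (Hm0 : m <> 0).
{ intro E; apply He0; rewrite E, Rinv_0; apply R3_eq; coords; cbn; ring. }
assert (Hm : m * m = inner Euclidean a a).
{ apply sqrt_sqrt; unfold inner; cbn [curvature]; nra. }
assert (Hee : inner Euclidean (scal (/ m) a) (scal (/ m) a) = 1).
{ rewrite inner_scal_l, inner_scal_r, <- Hm; field; exact Hm0. }
assert (Het : inner Euclidean (scal (/ m) a) t = 0).
{ rewrite inner_scal_l, H2; ring. }
assert (Hex : x1 (scal (/ m) a) = 0) by (rewrite x1_scal, Ha; ring).
set (e := scal (/ m) a) in *; clearbody e t; clear - Ho Ht H1 Hee Het Hex.
unfold det3, normal, inner in *; cbn [curvature] in *.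
rewrite x1_triple, x2_triple, x3_triple in Ho.
(* The determinant of (t, e) has square 1, by Lagrange's identity, and is
   positive. *)
assert (D : x2 t * x3 e - x3 t * x2 e = 1).
{ assert (S : (x2 t * x3 e - x3 t * x2 e) * (x2 t * x3 e - x3 t * x2 e) = 1)
    by nsatz.
  nra. }
clear Ho.
unfold rot, wedge, normal; apply R3_eq; coords; cbn [curvature]; nsatz.
Qed.

(** * The orthonormal frame along a geodesic ray *)

(** The derivative of exp_p (t v) in t, hence the vector v^p of the wavefront
    condition when t = r(s). *)
Definition ray_velocity (c : space_form) (p v : R3) (t : R) : R3 :=
  plus (scal (- curvature c * sin_ c t) p) (scal (cos_ c t) v).

Lemma is_derive3_Exp (c : space_form) (p v : R3) (t : R) :
  is_derive3 (Exp c p v) t (ray_velocity c p v t).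
Proof.
pose proof (is_derive3_plus _ _ _ _ _
  (is_derive3_scal _ _ _ _ _ (is_derive_cos_ c t) (is_derive3_const p t))
  (is_derive3_scal _ _ _ _ _ (is_derive_sin_ c t) (is_derive3_const v t))) as H.
match type of H with is_derive3 _ _ ?l =>
  replace (ray_velocity c p v t) with l; [exact H|] end.
unfold ray_velocity; apply R3_eq; coords; cbn; ring.
Qed.

Lemma inner_normal_tangent (c : space_form) (p v : R3) :
  tangent c p v -> inner c (normal c p) v = 0.
Proof.
destruct c; cbn [tangent normal]; try tauto.
intros _; unfold inner; coords; cbn [curvature]; ring.
Qed.

Lemma normal_Exp (c : space_form) (p v : R3) (t : R) :
  normal c (Exp c p v t) =
  plus (scal (cos_ c t) (normal c p))
       (scal (curvature c * curvature c * sin_ c t) v).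
Proof.
destruct c; unfold Exp; cbn [normal cos_ sin_ curvature];
  apply R3_eq; coords; ring.
Qed.

Lemma unit_normal_Exp (c : space_form) (p v : R3) (t : R) :
  unit_normal c p -> tangent c p v -> inner c v v = 1 ->
  unit_normal c (Exp c p v t).
Proof.
intros Hp Hv H1; unfold unit_normal in *; rewrite normal_Exp.
pose proof (cos_sin_sqr c t) as Hc.
rewrite !inner_plus_l, !inner_plus_r, !inner_scal_l, !inner_scal_r, Hp, H1,
  (inner_comm c v), (inner_normal_tangent _ _ _ Hv).
destruct c; cbn [curvature] in *; nsatz.
Qed.

Lemma tangent_ray_velocity (c : space_form) (p v : R3) (t : R) :
  in_M c p -> tangent c p v -> inner c v v = 1 ->
  tangent c (Exp c p v t) (ray_velocity c p v t).
Proof.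
intros Hp Hv H1; unfold Exp, ray_velocity.
destruct c; cbn [tangent in_M] in *.
2: { rewrite !x1_plus, !x1_scal, Hp, Hv; ring. }
all: rewrite !inner_plus_l, !inner_plus_r, !inner_scal_l, !inner_scal_r, H1,
  (inner_comm _ v), Hv; cbn [curvature].
- destruct Hp as [-> _]; ring.
- rewrite Hp; ring.
Qed.

Lemma inner_ray_velocity (c : space_form) (p v : R3) (t : R) :
  in_M c p -> tangent c p v -> inner c v v = 1 ->
  inner c (ray_velocity c p v t) (ray_velocity c p v t) = 1.
Proof.
intros Hp Hv H1; unfold ray_velocity.
pose proof (cos_sin_sqr c t) as Hc.
rewrite !inner_plus_l, !inner_plus_r, !inner_scal_l, !inner_scal_r, H1,
  (inner_comm c v).
destruct c; cbn [tangent in_M curvature] in *.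
- destruct Hp as [-> _]; rewrite Hv; nsatz.
- nsatz.
- rewrite Hp, Hv; nsatz.
Qed.

(** J v is parallel along the geodesic with initial velocity v, and the part of
    its ambient derivative normal to M_c is a multiple of <J v, v>_c = 0, so it is
    even constant as a vector of R3. This is why the component of d/ds F(s, r(s))
    across the ray is measured by the same vector J v at every time r(s). *)
Lemma rot_ray_velocity (c : space_form) (p v : R3) (t : R) :
  rot c (Exp c p v t) (ray_velocity c p v t) = rot c p v.
Proof.
pose proof (cos_sin_sqr c t) as Hc.
unfold rot; rewrite normal_Exp; unfold ray_velocity, wedge.
destruct c; cbn [normal curvature] in *; apply R3_eq; coords; nsatz.
Qed.

(** * The Frenet equations *)

Definition frenet (c : space_form) (g : R -> R3) (k s : R) : Prop :=
  is_derive3 (frame_t g) s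
    (plus (scal k (frame_e c g s)) (scal (- curvature c) (g s))) /\
  is_derive3 (frame_e c g) s (scal (- k) (frame_t g s)).

(** In the ambient space t' is the covariant acceleration k e plus a part normal
    to M_c, and differentiating <t, g>_c = 0 gives that part as - c g. Since
    e = J t with J = [rot], e' follows: the dependence of J on the base point
    contributes a multiple of t wedge t = 0, and J (c g) = 0, so that
    e' = J (k e) = k J J t = - k t. *)
Lemma frenet_equations (c : space_form) (L : R) (g : R -> R3) :
  convex_closed_curve c L g ->
  exists k : R -> R,
    (forall s, match c with Hyperbolic => 1 < k s | _ => 0 < k s end) /\
    (forall s, frenet c g (k s) s).
Proof.
intros hg; destruct (curve_convex _ _ _ hg) as [k [Hk Hpos]].
assert (Ht : forall s, is_derive3 (frame_t g) s
  (plus (scal (k s) (frame_e c g s)) (scal (- curvature c) (g s)))).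
{ intro s; pose proof (Derive3_correct_2 g s (curve_smooth _ _ _ hg)) as Hd.
  replace (plus _ _) with (Derive3 (Derive3 g) s); [exact Hd|].
  rewrite <- (proj2 (Hk s)); unfold cov_accel.
  rewrite (curvature_inner_accel _ _ _ s hg).
  apply R3_eq; unfold minus, opp, plus, scal; cbn; ring. }
exists k; split; [exact Hpos|].
intro s; split; [exact (Ht s)|].
pose proof (is_derive3_wedge c _ _ _ _ _
  (is_derive3_normal c _ _ _ (Derive3_correct g s (curve_smooth _ _ _ hg)))
  (Ht s)) as He.
apply (is_derive3_ext _ (frame_e c g)) in He;
  [|intro u; symmetry; exact (frame_e_rot _ _ _ u hg)].
match type of He with is_derive3 _ _ ?l =>
  replace (scal (- k s) (frame_t g s)) with l; [exact He|] end.
rewrite (frame_e_rot _ _ _ s hg).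
change (wedge c (normal c (g s)) ?x) with (rot c (g s) x).
rewrite rot_plus, !rot_scal, rot_rot.
- unfold frame_t; set (t := Derive3 g s); unfold rot, wedge.
  destruct c; apply R3_eq; coords; cbn [normal curvature]; coords; ring.
- apply in_M_unit_normal, (curve_in_M _ _ _ hg).
- exact (tangent_velocity _ _ _ s hg).
Qed.

(** * The differential of the ray family *)

(** The Jacobi field of the family of rays, that is, the component of F_s along
    J v_alpha, at time t and where the curvature of the curve is k. Its zeros
    are the focal times of the family. *)
Definition focal (c : space_form) (alpha k t : R) : R :=
  k * sin_ c t - sin alpha * cos_ c t.

Lemma tangent_valpha (c : space_form) (alpha L : R) (g : R -> R3) (s : R) :
  convex_closed_curve c L g -> tangent c (g s) (valpha c alpha g s).
Proof.
intros hg; unfold valpha; rewrite (frame_e_rot _ _ _ s hg).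
apply tangent_plus; apply tangent_scal;
  [exact (tangent_velocity _ _ _ s hg) | apply tangent_rot].
Qed.

Lemma inner_valpha (c : space_form) (alpha L : R) (g : R -> R3) (s : R) :
  convex_closed_curve c L g ->
  inner c (valpha c alpha g s) (valpha c alpha g s) = 1.
Proof.
intros hg; unfold valpha; rewrite (frame_e_rot _ _ _ s hg).
assert (Hp : unit_normal c (g s))
  by (apply in_M_unit_normal, (curve_in_M _ _ _ hg)).
pose proof (tangent_velocity _ _ _ s hg) as Ht.
rewrite !inner_plus_l, !inner_plus_r, !inner_scal_l, !inner_scal_r,
  (inner_comm c (rot _ _ _) (frame_t g s)), inner_rot, inner_rot_rot by assumption.
unfold frame_t; rewrite (inner_velocity _ _ _ s hg).
generalize (sin2_cos2 alpha); unfold Rsqr; lra.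
Qed.

Lemma rot_valpha (c : space_form) (alpha L : R) (g : R -> R3) (s : R) :
  convex_closed_curve c L g ->
  rot c (g s) (valpha c alpha g s) =
  plus (scal (- sin alpha) (frame_t g s)) (scal (cos alpha) (frame_e c g s)).
Proof.
intros hg; unfold valpha; rewrite (frame_e_rot _ _ _ s hg).
rewrite rot_plus, !rot_scal, rot_rot;
  [apply R3_eq; coords; ring
  |apply in_M_unit_normal, (curve_in_M _ _ _ hg)
  |exact (tangent_velocity _ _ _ s hg)].
Qed.

(** Allowing the time r to depend on s covers F_s (r constant) and the velocity
    of a wavefront at once. *)
Lemma is_derive3_front (c : space_form) (alpha L : R) (g : R -> R3) (k : R)
    (s : R) (r : R -> R) (r' : R) :
  convex_closed_curve c L g ->
  frenet c g k s ->
  is_derive r s r' ->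
  is_derive3 (fun u => Falpha c alpha g u (r u)) s
    (plus (scal (cos alpha + r')
             (ray_velocity c (g s) (valpha c alpha g s) (r s)))
          (scal (focal c alpha k (r s)) (rot c (g s) (valpha c alpha g s)))).
Proof.
intros hg [Ht He] Hr.
pose proof (Derive3_correct g s (curve_smooth _ _ _ hg)) as Hg.
change (Derive3 g s) with (frame_t g s) in Hg.
assert (Hv : is_derive3 (valpha c alpha g) s
  (plus (scal k (rot c (g s) (valpha c alpha g s)))
        (scal (- curvature c * cos alpha) (g s)))).
{ pose proof (is_derive3_plus _ _ _ _ _
    (is_derive3_scal (fun _ => cos alpha) _ s 0 _ (is_derive_const _ s) Ht)
    (is_derive3_scal (fun _ => sin alpha) _ s 0 _ (is_derive_const _ s) He))
    as H.
  match type of H with is_derive3 _ _ ?l => replace (plus _ _) with l end;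
    [exact H|].
  rewrite (rot_valpha _ _ _ _ _ hg); apply R3_eq; coords; ring. }
assert (Hcos : is_derive (fun u => cos_ c (r u)) s
  (r' * (- curvature c * sin_ c (r s))))
  by exact (is_derive_comp (cos_ c) r s _ _ (is_derive_cos_ c (r s)) Hr).
assert (Hsin : is_derive (fun u => sin_ c (r u)) s (r' * cos_ c (r s)))
  by exact (is_derive_comp (sin_ c) r s _ _ (is_derive_sin_ c (r s)) Hr).
pose proof (is_derive3_plus _ _ _ _ _
  (is_derive3_scal _ _ _ _ _ Hcos Hg) (is_derive3_scal _ _ _ _ _ Hsin Hv)) as H.
match type of H with is_derive3 _ _ ?l => replace (plus _ _) with l end;
  [exact H|].
assert (E : frame_t g s =
  plus (scal (cos alpha) (valpha c alpha g s))
       (scal (- sin alpha) (rot c (g s) (valpha c alpha g s)))).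
{ rewrite (rot_valpha _ _ _ _ _ hg); unfold valpha.
  pose proof (sin2_cos2 alpha) as S; unfold Rsqr in S.
  apply R3_eq; coords; nsatz. }
rewrite E at 1; unfold ray_velocity, focal; apply R3_eq; coords; ring.
Qed.

(** For d = 0 the tangent vector J u is missed; for d <> 0 solve for the
    coordinates with respect to (u, J u). *)
Lemma spanning_iff (c : space_form) (p u : R3) (m d : R) :
  unit_normal c p -> tangent c p u -> inner c u u = 1 ->
  (forall w, tangent c p w -> exists a b,
     w = plus (scal a (plus (scal m u) (scal d (rot c p u)))) (scal b u)) <->
  d <> 0.
Proof.
intros Hp Hu H1.
pose proof (inner_rot c p u) as H0.
pose proof (inner_rot_rot c p u Hp Hu) as Hr; rewrite H1 in Hr.
split.
- intros H E; destruct (H _ (tangent_rot c p u)) as [a [b Hw]].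
  pose proof (f_equal (inner c (rot c p u)) Hw) as K.
  rewrite !inner_plus_r, !inner_scal_r, !inner_plus_r, !inner_scal_r, Hr, E,
    (inner_comm c (rot c p u)), H0 in K; lra.
- intros Hd w Hw.
  pose proof (tangent_decomposition c p u w Hp Hu H1 Hw) as E.
  exists (inner c w (rot c p u) / d).
  exists (inner c w u - inner c w (rot c p u) / d * m).
  rewrite E at 1; apply R3_eq; coords; field; exact Hd.
Qed.

Lemma critical_point_iff (c : space_form) (alpha L : R) (g : R -> R3) (k : R)
    (s t : R) :
  convex_closed_curve c L g ->
  frenet c g k s ->
  critical_point c (Falpha c alpha g) s t <-> focal c alpha k t = 0.
Proof.
intros hg hf.
set (v := valpha c alpha g s).
pose proof (curve_in_M _ _ _ hg s) as HM.
pose proof (tangent_valpha c alpha L g s hg) as Hv; fold v in Hv.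
pose proof (inner_valpha c alpha L g s hg) as H1; fold v in H1.
pose proof (spanning_iff c (Exp c (g s) v t) (ray_velocity c (g s) v t)
  (cos alpha + 0) (focal c alpha k t)
  (unit_normal_Exp _ _ _ t (in_M_unit_normal _ _ HM) Hv H1)
  (tangent_ray_velocity _ _ _ t HM Hv H1)
  (inner_ray_velocity _ _ _ t HM Hv H1)) as H.
rewrite rot_ray_velocity in H.
unfold critical_point.
rewrite (is_derive3_unique _ _ _
  (is_derive3_front c alpha L g k s (fun _ => t) 0 hg hf
     (is_derive_const t s))).
change (Derive3 (fun u => Falpha c alpha g s u) t)
  with (Derive3 (Exp c (g s) v) t).
rewrite (is_derive3_unique _ _ _ (is_derive3_Exp c (g s) v t)).
change (Falpha c alpha g s t) with (Exp c (g s) v t).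
fold v; rewrite H.
destruct (Req_dec (focal c alpha k t) 0); tauto.
Qed.

(** Hence the wavefront condition is the differential equation
    r' = - cos alpha. *)
Lemma front_inner_ray_velocity (c : space_form) (alpha L : R) (g : R -> R3) (k : R)
    (s : R) (r : R -> R) (r' : R) :
  convex_closed_curve c L g ->
  frenet c g k s ->
  is_derive r s r' ->
  inner c (Derive3 (fun u => Falpha c alpha g u (r u)) s)
    (Derive3 (Exp c (g s) (valpha c alpha g s)) (r s)) = cos alpha + r'.
Proof.
intros hg hf Hr.
rewrite (is_derive3_unique _ _ _
  (is_derive3_front c alpha L g k s r r' hg hf Hr)).
rewrite (is_derive3_unique _ _ _ (is_derive3_Exp c _ _ (r s))).
rewrite inner_plus_l, !inner_scal_l, inner_ray_velocity.
- rewrite <- (rot_ray_velocity c _ _ (r s)) at 1.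
  rewrite (inner_comm c (rot _ _ _)), inner_rot; ring.
- apply (curve_in_M _ _ _ hg).
- exact (tangent_valpha _ _ _ _ _ hg).
- exact (inner_valpha _ _ _ _ _ hg).
Qed.

Lemma front_singular_iff (c : space_form) (alpha L : R) (g : R -> R3) (k : R)
    (s : R) (r : R -> R) (r' : R) :
  convex_closed_curve c L g ->
  frenet c g k s ->
  is_derive r s r' ->
  Derive3 (fun u => Falpha c alpha g u (r u)) s = zero <->
  cos alpha + r' = 0 /\ focal c alpha k (r s) = 0.
Proof.
intros hg hf Hr.
pose proof (front_inner_ray_velocity c alpha L g k s r r' hg hf Hr) as HO.
rewrite (is_derive3_unique _ _ _
  (is_derive3_front c alpha L g k s r r' hg hf Hr)) in *.
set (w := rot c (g s) (valpha c alpha g s)) in *.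
split.
- intros Z; rewrite Z in HO.
  assert (Hm : cos alpha + r' = 0)
    by (rewrite <- HO; unfold inner, zero; cbn; ring).
  split; [exact Hm|].
  pose proof (f_equal (inner c w) Z) as K.
  rewrite inner_plus_r, !inner_scal_r, Hm in K.
  unfold w in K at 2 3; rewrite inner_rot_rot, (inner_valpha _ _ L) in K.
  + replace (inner c w zero) with 0 in K by (unfold inner; cbn; ring).
    lra.
  + exact hg.
  + apply in_M_unit_normal, (curve_in_M _ _ _ hg).
  + exact (tangent_valpha _ _ _ _ _ hg).
- intros [-> ->]; apply R3_eq; coords; cbn; ring.
Qed.

(** At a focal time sin alpha cos_c(t) = k sin_c(t). For c = 0 this reads
    t = sin alpha / k. For c = -1 it reads tanh t = sin alpha / k. Neither is
    negative. For c = 1 there are focal times of both signs, but the ray is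
    2 pi periodic. *)
Lemma focal_at_nonneg_time (c : space_form) (alpha k t : R) (p v : R3) :
  0 <= sin alpha ->
  match c with Hyperbolic => 1 < k | _ => 0 < k end ->
  focal c alpha k t = 0 ->
  exists t', 0 <= t' /\ focal c alpha k t' = 0 /\ Exp c p v t' = Exp c p v t.
Proof.
intros Ha Hk Hf.
destruct c; unfold focal in *; cbn [cos_ sin_] in *.
- exists t; split; [|tauto].
  destruct (Rle_or_lt 0 t) as [H|H]; [exact H|exfalso].
  apply sinh_lt in H; rewrite sinh_0 in H.
  assert (0 < cosh t).
  { unfold cosh; generalize (exp_pos t), (exp_pos (- t)); lra. }
  nra.
- exists t; split; [|tauto]; nra.
- destruct (INR_unbounded (- t)) as [n Hn].
  exists (t + 2 * INR n * PI).
  unfold Exp; cbn [cos_ sin_]; rewrite cos_period, sin_period.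
  split; [|tauto].
  (* PI / 2 > 1, so a shift by 2 n PI with n > - t suffices. *)
  generalize PI2_1, (pos_INR n); nra.
Qed.

(** * Evolutoids and singular points of wavefronts *)

Theorem theorem7 (c : space_form) (alpha : R) (halpha : 0 <= alpha <= PI / 2)
    (L : R) (g : R -> R3) (hg : convex_closed_curve c L g) :
  forall p : R3,
    evolutoid c alpha L g p <->
    exists (sigma : R -> R3) (s : R),
      wavefront c alpha L g sigma /\
      0 <= s <= L /\ Derive3 sigma s = zero /\ p = sigma s.
Proof.
intro p.
destruct (frenet_equations c L g hg) as [k [Hk Hfr]].
split.
- intros [s [t [Hs [Ht0 [Hc ->]]]]].
  rewrite (critical_point_iff c alpha L g (k s) s t hg (Hfr s)) in Hc.
  (* The solution of r' = - cos alpha that takes the value t at s. *)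
  set (r := fun u => t - (u - s) * cos alpha).
  assert (Hr : forall u, is_derive r u (- cos alpha)).
  { intro u; unfold r; auto_derive; [exact I | ring]. }
  assert (Hrs : r s = t) by (unfold r; ring).
  exists (fun u => Falpha c alpha g u (r u)), s; split; [|split; [exact Hs|split]].
  + exists r; split; [reflexivity|].
    intros u _; split; [exists (- cos alpha); apply Hr|].
    rewrite (front_inner_ray_velocity c alpha L g (k u) u r _ hg (Hfr u) (Hr u)).
    ring.
  + apply (front_singular_iff c alpha L g (k s) s r _ hg (Hfr s) (Hr s)).
    rewrite Hrs; split; [ring | exact Hc].
  + rewrite Hrs; reflexivity.
- intros [sigma [s [[r [Hsig Hr]] [Hs [Hz ->]]]]].
  destruct (Hr s Hs) as [[r' Hr'] _].
  assert (Hz' : Derive3 (fun u => Falpha c alpha g u (r u)) s = zero).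
  { rewrite <- Hz; apply R3_eq; apply Derive_ext; intro u; rewrite Hsig;
      reflexivity. }
  apply (front_singular_iff c alpha L g (k s) s r r' hg (Hfr s) Hr')
    in Hz'.
  destruct (focal_at_nonneg_time c alpha (k s) (r s) (g s) (valpha c alpha g s))
    as [t [Ht0 [Hf E]]].
  + apply sin_ge_0; [apply halpha | generalize PI_RGT_0; lra].
  + apply Hk.
  + apply Hz'.
  + exists s, t; split; [exact Hs|split; [exact Ht0|split]].
    * apply (critical_point_iff c alpha L g (k s) s t hg (Hfr s)); exact Hf.
    * rewrite Hsig; symmetry; exact E.
Qed.
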